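(* Hypersimplices, and hence matroid polytopes, are not reconstructible from their graphs and dimension. That is, there exist integers $0<r<n$ and a polytope $Q$ of dimension $\dim\Delta(r,n)=n-1$ such that the vertex-edge graphs of $Q$ and of the hypersimplex $\Delta(r,n)$ are isomorphic, but $Q$ and $\Delta(r,n)$ are not combinatorially equivalent.
   Context: For integers $0<r<n$, the hypersimplex is $\Delta(r,n)=\{x\in[0,1]^n : \sum_{i=1}^n x_i=r\}$; it is the matroid polytope of the uniform matroid $U_{r,n}$ (the matroid on $n$ elements in which every $r$-subset is a basis), where the matroid polytope of a matroid is the convex hull of the 0/1 indicator vectors of its bases. The vertex-edge graph of a polytope is the graph formed by its vertices and one-dimensional faces. Two polytopes are combinatorially equivalent if there is an inclusion-preserving bijection between their face lattices. A $d$-polytope is reconstructible from its graph and dimension if, up to combinatorial equivalence, it is the only $d$-polytope (among all $d$-polytopes) with that vertex-edge graph. *)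

(* Defs.v *)
From HB Require Import structures.
From mathcomp Require Import all_boot all_order all_algebra.
From mathcomp Require Import boolp classical_sets functions cardinality reals.

Set Implicit Arguments.
Unset Strict Implicit.
Unset Printing Implicit Defensive.

Import Order.TTheory GRing.Theory Num.Theory.

Local Open Scope classical_set_scope.
Local Open Scope ring_scope.

Section Polytopes.
Variable R : realType.

Definition convex_hull n (S : set 'rV[R]_n) : set 'rV[R]_n :=
  [set x | exists (k : nat) (t : 'I_k -> R) (p : 'I_k -> 'rV[R]_n),
     [/\ forall i, 0 <= t i, \sum_i t i = 1,
         forall i, S (p i) & x = \sum_i t i *: p i]].

Definition affine_hull n (S : set 'rV[R]_n) : set 'rV[R]_n :=
  [set x | exists (k : nat) (t : 'I_k -> R) (p : 'I_k -> 'rV[R]_n),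
     [/\ \sum_i t i = 1, forall i, S (p i) & x = \sum_i t i *: p i]].

Definition is_polytope n (P : set 'rV[R]_n) : Prop :=
  exists2 S : set 'rV[R]_n, finite_set S & P = convex_hull S.

(* The dimension is that of the affine hull, a translate of a linear subspace;
   the empty set has no dimension in this sense. *)
Definition has_dim n (A : set 'rV[R]_n) (d : nat) : Prop :=
  exists (x0 : 'rV[R]_n) (U : {vspace 'rV[R]_n}),
    \dim U = d /\ affine_hull A = [set x0 + u | u in [set` U]].

(* Faces are cut out by valid inequalities. Since c = 0 is allowed, both P
   (b = 0) and the empty set (b = 1) are faces of P. *)
Definition is_face n (P F : set 'rV[R]_n) : Prop :=
  exists (c : 'rV[R]_n) (b : R),
    (forall x, P x -> \sum_i c 0 i * x 0 i <= b) /\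
    F = P `&` [set x | \sum_i c 0 i * x 0 i = b].

Definition faces n (P : set 'rV[R]_n) : set (set 'rV[R]_n) :=
  [set F | is_face P F].

Definition vertices n (P : set 'rV[R]_n) : set 'rV[R]_n :=
  [set v | is_face P [set v]].

Definition adjacent n (P : set 'rV[R]_n) (u v : 'rV[R]_n) : Prop :=
  [/\ vertices P u, vertices P v, u <> v &
      exists F, [/\ is_face P F, has_dim F 1, F u & F v]].

Definition graph_isomorphic m n (P : set 'rV[R]_m) (Q : set 'rV[R]_n) : Prop :=
  exists f : 'rV[R]_m -> 'rV[R]_n,
    set_bij (vertices P) (vertices Q) f /\
    forall u v, vertices P u -> vertices P v ->
      (adjacent P u v <-> adjacent Q (f u) (f v)).

Definition combinatorially_equivalent m n
    (P : set 'rV[R]_m) (Q : set 'rV[R]_n) : Prop :=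
  exists phi : set 'rV[R]_m -> set 'rV[R]_n,
    set_bij (faces P) (faces Q) phi /\
    forall F G, faces P F -> faces P G -> (F `<=` G <-> phi F `<=` phi G).

Definition reconstructible n (P : set 'rV[R]_n) : Prop :=
  forall (d m : nat) (Q : set 'rV[R]_m),
    has_dim P d -> is_polytope Q -> has_dim Q d ->
    graph_isomorphic Q P -> combinatorially_equivalent Q P.

Definition hypersimplex (r n : nat) : set 'rV[R]_n :=
  [set x | (forall i, 0 <= x 0 i <= 1) /\ \sum_i x 0 i = r%:R].

End Polytopes.

Record matroid (n : nat) := Matroid {
  bases : {set {set 'I_n}};
  bases_neq0 : bases != finset.set0;
  bases_exchange : forall (A B : {set 'I_n}) (a : 'I_n),
    A \in bases -> B \in bases -> a \in A :\: B ->
    exists2 b, b \in B :\: A & b |: (A :\ a) \in bases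
}.

Definition indicator_vector (R : realType) n (B : {set 'I_n}) : 'rV[R]_n :=
  \row_i (i \in B)%:R.

Definition matroid_polytope (R : realType) n (M : matroid n) : set 'rV[R]_n :=
  convex_hull [set indicator_vector R B | B in [set` bases M]].

Arguments hypersimplex R r n : clear implicits.
Arguments matroid_polytope R {n} M.

(* Main.v *)
Require Import Defs.
From mathcomp Require Import all_boot all_order all_algebra.
From mathcomp Require Import boolp classical_sets functions cardinality reals.
From mathcomp Require Import perm ring lra.

(* Take the hypersimplex of type (2, 5) and push its vertex e_1 + e_2 towards
   the interior of the polytope, beyond the hyperplane x_1 + x_2 = 1 only. The
   six neighbours of the vertex span a prism in that hyperplane, so the edges do
   not change, but each of the three octahedral facets through the vertex breaks
   into two pyramids over a square. That square is a new face with four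
   vertices, whereas a face of the hypersimplex containing two nonadjacent
   vertices e_a + e_b and e_c + e_d contains the whole octahedron on a, b, c, d.
   Faces and non-faces are certified by integral functionals and by integral
   affine dependencies, which are checked by computation. *)

Set Implicit Arguments.
Unset Strict Implicit.
Unset Printing Implicit Defensive.

Import Order.TTheory GRing.Theory Num.Theory.

Local Open Scope classical_set_scope.
Local Open Scope ring_scope.

(** * Faces of the convex hull of an indexed finite family of points *)

Section Hull.
Variables (R : realType) (n : nat).

Definition dot (c x : 'rV[R]_n) : R := \sum_i c 0 i * x 0 i.

Lemma dot_sumr c (I : Type) (r : seq I) (w : I -> R) (p : I -> 'rV[R]_n) :
  dot c (\sum_(i <- r) w i *: p i) = \sum_(i <- r) w i * dot c (p i).
Proof.
rewrite /dot; under eq_bigr do rewrite summxE mulr_sumr.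
rewrite exchange_big; apply: eq_bigr => i _ /=; rewrite mulr_sumr.
by apply: eq_bigr => j _; rewrite mxE mulrCA.
Qed.

Lemma convex_hull_convex (S : set 'rV[R]_n) (a b : R) (x y : 'rV[R]_n) :
  0 <= a -> 0 <= b -> a + b = 1 ->
  convex_hull S x -> convex_hull S y -> convex_hull S (a *: x + b *: y).
Proof.
move=> a0 b0 ab [k [t [p [t0 t1 Sp ->]]]] [l [u [q [u0 u1 Sq ->]]]].
exists (k + l)%N.
exists (fun i => match fintype.split i with inl i => a * t i | inr i => b * u i end).
exists (fun i => match fintype.split i with inl i => p i | inr i => q i end).
have sl (i : 'I_k) : fintype.split (lshift l i) = inl i := unsplitK (inl i).
have sr (i : 'I_l) : fintype.split (rshift k i) = inr i := unsplitK (inr i).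
split=> [i||i|].
- by case: fintype.split => j; rewrite mulr_ge0.
- rewrite big_split_ord /=; under eq_bigr do rewrite sl.
  under [X in _ + X]eq_bigr do rewrite sr.
  by rewrite -!mulr_sumr t1 u1 !mulr1.
- by case: fintype.split.
- rewrite big_split_ord /= !scaler_sumr; congr (_ + _).
    by apply: eq_bigr => i _; rewrite sl scalerA.
  by apply: eq_bigr => i _; rewrite sr scalerA.
Qed.

Lemma sub_convex_hull (S : set 'rV[R]_n) : S `<=` convex_hull S.
Proof.
move=> x Sx; exists 1%N, (fun=> 1), (fun=> x).
by split=> // [|]; rewrite big_ord1 // scale1r.
Qed.

Lemma collinear_dim1 (F : set 'rV[R]_n) (x y z : 'rV[R]_n) : has_dim F 1 ->
  F x -> F y -> x <> y -> F z -> exists g, z = x + g *: (y - x).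
Proof.
move=> [x0 [U [U1 FU]]] Fx Fy /eqP xy Fz.
have FUP t : F t -> t - x0 \in U.
  move=> Ft; have : affine_hull F t.
    exists 1%N, (fun=> 1), (fun=> t).
    by split=> // [|]; rewrite big_ord1 // scale1r.
  by rewrite FU => -[u uU <-]; rewrite addrAC subrr add0r.
have sub t : F t -> t - x \in U.
  move=> /FUP tU; have -> : t - x = (t - x0) - (x - x0).
    by rewrite opprB addrA subrK.
  by rewrite rpredB // FUP.
have /eqP UE : (<[y - x]> == U)%VS.
  by rewrite eqEdim -memvE sub //= U1 dim_vline subr_eq0 eq_sym xy.
have := sub _ Fz; rewrite -UE => /vlineP[g gE].
by exists g; rewrite -gE addrCA subrr addr0.
Qed.

Lemma has_dim_segment (F : set 'rV[R]_n) (x y : 'rV[R]_n) : F x -> F y ->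
  x <> y -> (forall z, F z -> exists g, z = x + g *: (y - x)) -> has_dim F 1.
Proof.
move=> Fx Fy /eqP xy FE; exists x, <[y - x]>%VS; split.
  by rewrite dim_vline subr_eq0 eq_sym xy.
apply/seteqP; split=> [z [k [t [r [t1 Fr ->]]]]|z [u /= /vlineP[g ->] <-]].
  have [g gE] := choice (fun i => FE _ (Fr i)).
  exists ((\sum_i t i * g i) *: (y - x)) => /=; first exact/vlineP/ex_intro.
  under [RHS]eq_bigr do rewrite gE scalerDr scalerA.
  by rewrite big_split -!scaler_suml t1 scale1r.
exists 2%N, (fun i => if i == ord0 then 1 - g else g).
exists (fun i => if i == ord0 then x else y); split.
- by rewrite big_ord_recl big_ord1 /= subrK.
- by move=> i; case: ifP.
- by rewrite big_ord_recl big_ord1 /= scalerBl scale1r scalerBr addrAC addrA.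
Qed.

Variables (I : finType) (p : I -> 'rV[R]_n).
Implicit Types (A B : {set I}) (F : set 'rV[R]_n) (c v x : 'rV[R]_n).

Definition hull : set 'rV[R]_n := convex_hull (range p).

(** A face is encoded by the indices of the points on it, so the face lattice becomes a finite
    family of subsets of [I]. The [iff] asks for equality exactly on [A]. *)
Definition facial A : Prop :=
  exists c b, forall i, dot c (p i) <= b ?= iff (i \in A).

Definition face_of A : set 'rV[R]_n :=
  [set x | exists w : I -> R,
     [/\ forall i, 0 <= w i, forall i, i \notin A -> w i = 0,
         \sum_i w i = 1 & x = \sum_i w i *: p i]].

Lemma hullE : hull = face_of finset.setT.
Proof.
apply/seteqP; split=> x; last first.
  move=> [w [w0 _ w1 ->]].
  exists #|I|, (w \o enum_val), (p \o enum_val); split=> [i||i|].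
  - exact: w0.
  - by rewrite -w1 [RHS](reindex _ (onW_bij _ (@enum_val_bij I))).
  - by exists (enum_val i).
  - by rewrite [LHS](reindex _ (onW_bij _ (@enum_val_bij I))).
move=> [k [t [q [t0 t1 rq ->]]]].
have /choice[f fE] : forall j, exists i, q j = p i.
  by move=> j; have [i _ <-] := rq j; exists i.
exists (fun i => \sum_(j | f j == i) t j); split=> [i|i||].
- exact: sumr_ge0.
- by rewrite inE.
- by rewrite -t1 [RHS](partition_big f predT).
- rewrite (partition_big f predT) //=; apply: eq_bigr => i _.
  rewrite scaler_suml; apply: eq_bigr => j /eqP <-.
  by rewrite fE.
Qed.

Lemma face_of_sub A B : A \subset B -> face_of A `<=` face_of B.
Proof.
move=> /fintype.subsetP AB x [w [w0 wA w1 ->]]; exists w; split=> // i iB.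
by apply: wA; apply: contra iB; exact: AB.
Qed.

Lemma sum_delta (i : I) : \sum_j (j == i)%:R = 1 :> R.
Proof. by rewrite (bigD1 i) //= eqxx big1 ?addr0 // => j /negPf->. Qed.

Lemma sum_deltaZ i : \sum_j (j == i)%:R *: p j = p i.
Proof.
rewrite (bigD1 i) //= eqxx scale1r big1 ?addr0 // => j /negPf->.
by rewrite scale0r.
Qed.

Lemma mem_face_of A i : i \in A -> face_of A (p i).
Proof.
move=> iA; exists (fun j => (j == i)%:R); split=> [j|j||].
- exact: ler0n.
- by case: eqP => // ->; rewrite iA.
- exact: sum_delta.
- by rewrite sum_deltaZ.
Qed.

Lemma mem_hull i : hull (p i).
Proof. by rewrite hullE; apply: mem_face_of; rewrite inE. Qed.

Lemma hull_dot_le c b x : (forall i, dot c (p i) <= b) -> hull x -> dot c x <= b.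
Proof.
rewrite hullE => cb [w [w0 _ w1 ->]]; rewrite dot_sumr.
rewrite -[b]mul1r -w1 mulr_suml; apply: ler_sum => i _.
exact: ler_wpM2l.
Qed.

Lemma weight_dot_eq c b (w : I -> R) i : (forall i, dot c (p i) <= b) ->
  (forall i, 0 <= w i) -> \sum_i w i * dot c (p i) = (\sum_i w i) * b ->
  0 < w i -> dot c (p i) = b.
Proof.
move=> cb w0 E wi.
have /eqP : \sum_i w i * (b - dot c (p i)) = 0.
  under eq_bigr do rewrite mulrBr.
  by rewrite sumrB -mulr_suml -E subrr.
rewrite psumr_eq0 => [|j _]; last by rewrite mulr_ge0 // subr_ge0.
move=> /allP /(_ i); rewrite mem_index_enum => /(_ isT) /=.
by rewrite mulf_eq0 gt_eqF //= subr_eq0 => /eqP.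
Qed.

Lemma face_ofE A c b : (forall i, dot c (p i) <= b ?= iff (i \in A)) ->
  face_of A = hull `&` [set x | dot c x = b].
Proof.
move=> cA; apply/seteqP; split=> [x Ax|x].
  split; first by rewrite hullE; apply: face_of_sub Ax; exact: finset.subsetT.
  have [w [w0 wA w1 ->]] := Ax; rewrite /= dot_sumr -[RHS]mul1r -w1 mulr_suml.
  apply: eq_bigr => i _; have [|/wA->] := boolP (i \in A).
    by rewrite -(cA i).2 => /eqP ->.
  by rewrite !mul0r.
rewrite hullE => -[[w [w0 _ w1 xE]]] /= cx; exists w; split=> // i iA.
apply/eqP; apply: contraNT iA => wi.
rewrite -(cA i).2; apply/eqP; apply: (weight_dot_eq (w := w)) => //.
- by move=> j; exact: (cA j).1.
- by rewrite -dot_sumr -xE w1 mul1r.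
- by rewrite lt_neqAle eq_sym wi w0.
Qed.

(** A valid inequality cuts out the convex hull of the points that attain its bound; their indices
    form [A]. *)
Lemma is_face_hullP F : is_face hull F <-> exists2 A, facial A & F = face_of A.
Proof.
split=> [[c [b [cb ->]]]|[A [c [b cA]] ->]]; last first.
  exists c, b; split; last exact: face_ofE.
  by move=> x; apply: (@hull_dot_le c) => i; exact: (cA i).1.
have cA i : dot c (p i) <= b ?= iff (i \in [set i | dot c (p i) == b]%SET).
  by rewrite inE; split=> //; apply: cb; exact: mem_hull.
by exists [set i | dot c (p i) == b]%SET; [exists c, b | rewrite (face_ofE cA)].
Qed.

Lemma face_facial A : facial A -> is_face hull (face_of A).
Proof. by move=> fA; apply/is_face_hullP; exists A. Qed.

Lemma face_of_mem A i : facial A -> face_of A (p i) <-> i \in A.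
Proof.
move=> [c [b cA]]; rewrite (face_ofE cA) -(cA i).2 /=; split=> [[_ /eqP]//|/eqP].
by split=> //; exact: mem_hull.
Qed.

Lemma face_of_subE A B : facial A -> facial B ->
  face_of A `<=` face_of B <-> A \subset B.
Proof.
move=> fA fB; split=> [AB|]; last exact: face_of_sub.
by apply/fintype.subsetP => i iA; apply/(face_of_mem _ fB)/AB/mem_face_of.
Qed.

Lemma face_of_inj A B : facial A -> facial B -> face_of A = face_of B -> A = B.
Proof.
move=> fA fB AB; apply/eqP.
rewrite finset.eqEsubset; apply/andP.
by split; apply/face_of_subE => //; rewrite AB.
Qed.

Lemma face_of_set1 i : face_of [set i]%SET = [set p i].
Proof.
apply/seteqP; split=> [x [w [w0 wA w1 ->]]|_ ->]; last first.
  by apply: mem_face_of; rewrite inE.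
have wN j : j != i -> w j = 0 by move=> ji; apply: wA; rewrite inE.
rewrite (bigD1 i) //= big1 => [|j /wN->]; last by rewrite scale0r.
move: w1; rewrite (bigD1 i) //= big1 => [|j /wN//].
by rewrite !addr0 => ->; rewrite scale1r.
Qed.

Lemma face_of_set0 : face_of finset.set0 = set0.
Proof.
apply/seteqP; split=> // x [w [_ w0 + _]].
rewrite big1 => [/esym/eqP|i _]; first by rewrite oner_eq0.
by apply: w0; rewrite inE.
Qed.

Lemma facial_set0 : facial finset.set0.
Proof.
exists 0, 1 => i; rewrite inE /dot big1 => [|j _]; last by rewrite mxE mul0r.
by split; [exact: ler01 | rewrite eq_sym oner_eq0].
Qed.

(** The tool for refuting faces: the combination [u] on [A] satisfies the equation of the face,
    hence so does the equal combination [w], and a nonnegative one can do so only with its weight on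
    [A]. *)
Lemma facial_weights A (u w : I -> R) k : facial A ->
  (forall i, 0 <= w i) -> (forall i, u i != 0 -> i \in A) ->
  \sum_i u i = \sum_i w i -> \sum_i u i *: p i = \sum_i w i *: p i ->
  0 < w k -> k \in A.
Proof.
move=> [c [b cA]] w0 uA uw E wk; rewrite -(cA k).2; apply/eqP.
apply: (weight_dot_eq _ w0 _ wk) => [i|]; first exact: (cA i).1.
rewrite -dot_sumr -E dot_sumr -uw mulr_suml; apply: eq_bigr => i _.
have [->|/uA] := eqVneq (u i) 0; first by rewrite !mul0r.
by rewrite -(cA i).2 => /eqP->.
Qed.

Hypothesis facial1 : forall i, facial [set i]%SET.

Lemma config_inj : injective p.
Proof.
move=> i j ij; apply/eqP; rewrite eq_sym -finset.in_set1.
by apply/(face_of_mem _ (facial1 i)); rewrite -ij; apply/mem_face_of/finset.set11.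
Qed.

Lemma vertices_hull : vertices hull = range p.
Proof.
apply/seteqP; split=> [v|_ [i _ <-]]; last first.
  by rewrite /vertices /= -face_of_set1; exact: face_facial.
move=> /is_face_hullP[A fA AE].
have [A0|[i iA]] := set_0Vmem A.
  by have : [set v] v := erefl; rewrite AE A0 face_of_set0.
by exists i => //; have := mem_face_of iA; rewrite -AE.
Qed.

(** The weights [1 - g] on [i] and [g] on [j] represent the point [k], whose singleton is facial, so
    every index of positive weight is [k]. *)
Lemma between_vertices i j k (g : R) : 0 <= g <= 1 ->
  p k = p i + g *: (p j - p i) -> k = i \/ k = j.
Proof.
move=> /andP[g0 g1] kE.
have fk := facial1 k; pose w l := (1 - g) * (l == i)%:R + g * (l == j)%:R.
have w0 l : 0 <= w l by rewrite addr_ge0 ?mulr_ge0 ?subr_ge0 ?ler0n.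
have H l : 0 < w l -> l = k.
  move=> wl; apply/eqP; rewrite -finset.in_set1.
  apply: (facial_weights (u := fun m => (m == k)%:R) fk w0 _ _ _ wl).
  - by move=> m; rewrite finset.in_set1; case: (m == k) => //=; rewrite eqxx.
  - by rewrite /w big_split /= -!mulr_sumr !sum_delta; ring.
  - rewrite sum_deltaZ kE /w; under [RHS]eq_bigr do rewrite scalerDl -!scalerA.
    rewrite big_split /= -!scaler_sumr !sum_deltaZ scalerBr scalerBl scale1r addrA.
    by rewrite addrAC.
have [g00|gn0] := eqVneq g 0.
  left; apply/esym/H; rewrite /w g00 eqxx subr0 mul0r addr0 mulr1; exact: ltr01.
right; apply/esym/H; rewrite /w eqxx.
have g00 : 0 < g by rewrite lt_neqAle eq_sym gn0.
by rewrite mulr1 ltr_wpDl // mulr_ge0 ?subr_ge0 ?ler0n.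
Qed.

(** The points of a one-dimensional face are collinear, and among three collinear vertices one would
    lie between the other two. *)
Lemma adjacent_hullP i j :
  adjacent hull (p i) (p j) <-> i != j /\ facial [set i; j]%SET.
Proof.
split=> [[_ _ pij [F [+ F1 Fi Fj]]]|[ij fij]].
  move=> /is_face_hullP[A fA AE].
  have ij : i != j by apply/eqP => ij; apply: pij; rewrite ij.
  move: Fi Fj F1; rewrite AE => Ai Aj A1.
  suff <- : A = [set i; j]%SET by [].
  apply/setP => k; rewrite in_set2; apply/idP/orP => [kA|[|]/eqP->]; last 2 first.
  - exact/(face_of_mem _ fA).
  - exact/(face_of_mem _ fA).
  have [g kE] := collinear_dim1 A1 Ai Aj pij (mem_face_of kA).
  suff [->|->] : k = i \/ k = j by rewrite eqxx; auto.
  (* The middle point of the three is [p i] for [g < 0], [p j] for [g > 1], and [p k] otherwise. *)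
  have [g0|g0] := ltP g 0.
    have g1 : 1 - g != 0 by rewrite gt_eqF // subr_gt0 (lt_trans g0).
    have [] : i = j \/ i = k; last 2 first.
    - by move=> ijE; rewrite ijE eqxx in ij.
    - by left.
    apply: (@between_vertices _ _ _ (1 - g)^-1).
      by rewrite invr_ge0 invf_le1 ?subr_ge0 ?subr_gt0 ?(lt_trans g0)//; lra.
    rewrite kE; apply/rowP => l; rewrite !mxE; field.
    by [].
  have [g1|g1] := leP g 1.
    by apply: (between_vertices _ kE); rewrite g0.
  have gn : g != 0 by rewrite gt_eqF // (lt_trans _ g1).
  have [] : j = i \/ j = k; last 2 first.
  - by move=> ijE; rewrite ijE eqxx in ij.
  - by right.
  apply: (@between_vertices _ _ _ g^-1).
    by rewrite invr_ge0 g0 /= invf_le1 ?(lt_trans _ g1)// ltW.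
  rewrite kE; apply/rowP => l; rewrite !mxE; field.
  by [].
have pij : p i <> p j by move=> /config_inj/eqP; exact/negP.
split=> //; rewrite ?vertices_hull; [by exists i|by exists j|].
exists (face_of [set i; j]%SET); split.
- exact: face_facial.
- apply: (has_dim_segment (x := p i) (y := p j)) => //.
  + by apply: mem_face_of; rewrite in_set2 eqxx.
  + by apply: mem_face_of; rewrite in_set2 eqxx orbT.
  move=> x [w [w0 wN w1 ->]]; exists (w j).
  rewrite (bigD1 i) //= (bigD1 j) 1?eq_sym //= big1 => [|k /andP[ki kj]]; last first.
    by rewrite wN ?scale0r // in_set2 negb_or ki.
  move: w1; rewrite (bigD1 i) //= (bigD1 j) 1?eq_sym //= big1 => [|k /andP[ki kj]]; last first.
    by rewrite wN // in_set2 negb_or ki.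
  rewrite !addr0 => /(canRL (addrK _)) ->.
  by rewrite scalerBl scale1r scalerBr addrAC addrA.
- by apply: mem_face_of; rewrite in_set2 eqxx.
- by apply: mem_face_of; rewrite in_set2 eqxx orbT.
Qed.

End Hull.

(** * From polytopes to the facial index sets of two configurations *)

Section TwoConfigurations.
Variables (R : realType) (m n : nat) (I : finType).
Variables (p : I -> 'rV[R]_m) (q : I -> 'rV[R]_n).
Hypothesis p1 : forall i, facial p [set i]%SET.
Hypothesis q1 : forall i, facial q [set i]%SET.

Lemma graph_isomorphic_hull :
  (forall i j, facial p [set i; j]%SET <-> facial q [set i; j]%SET) ->
  graph_isomorphic (hull p) (hull q).
Proof.
(* The value 0 off the vertices is a default that is never inspected. *)
move=> pq; pose f x := if [pick i | p i == x] is Some i then q i else 0.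
have fp i : f (p i) = q i.
  rewrite /f; case: pickP => [j /eqP/(config_inj p1)->//|/(_ i)].
  by rewrite eqxx.
exists f; rewrite !vertices_hull //; split.
  split.
  - by move=> _ [i _ <-]; exists i.
  - move=> x y; rewrite !inE => -[i _ <-] [j _ <-].
    by rewrite !fp => /(config_inj q1)->.
  - by move=> _ [i _ <-]; exists (p i); [exists i|].
move=> _ _ [i _ <-] [j _ <-]; rewrite !fp.
by rewrite !adjacent_hullP // pq.
Qed.

(** An isomorphism of face lattices permutes the atoms, which are the vertices, and acts on every
    face through the vertices it contains. *)
Lemma combinatorially_equivalent_hull :
  combinatorially_equivalent (hull p) (hull q) ->
  exists2 s : {perm I},
    forall A, facial p A -> facial q (s @: A) &
    forall A, facial q A -> facial p (s @^-1: A).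
Proof.
move=> [phi [[phiF phiI phiS] phiO]].
have phi_face A : facial p A ->
    exists2 B, facial q B & phi (face_of p A) = face_of q B.
  by move=> fA; apply/is_face_hullP/phiF; exact: face_facial.
(* [psi] is [phi] read on index sets, with arbitrary values on non-facial sets. *)
have /choice[psi psiP] : forall A, exists B, facial p A ->
    facial q B /\ phi (face_of p A) = face_of q B.
  move=> A; have [/phi_face[B fB E]|nA] := pselect (facial p A).
    by exists B.
  by exists A => /nA.
have psi_sub A B : facial p A -> facial p B -> (psi A \subset psi B) = (A \subset B).
  move=> fA fB; have [fA' EA] := psiP _ fA; have [fB' EB] := psiP _ fB.
  apply/idP/idP => [|] /face_of_subE.
    move=> /(_ _ _ _ fA' fB'); rewrite -EA -EB => H.
    by apply/(face_of_subE fA fB)/phiO => //; exact: face_facial.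
  move=> /(_ _ _ _ fA fB) H; apply/(face_of_subE fA' fB').
  by rewrite -EA -EB; apply/phiO => //; exact: face_facial.
have psi_surj B : facial q B -> exists2 A, facial p A & psi A = B.
  move=> fB; have [F FF FE] := phiS _ (face_facial fB).
  have [A fA AE] := (is_face_hullP p F).1 FF.
  exists A => //; have [fA' EA] := psiP _ fA.
  by apply: (face_of_inj fA' fB); rewrite -EA -AE.
have psi0 : psi finset.set0 = finset.set0.
  have [A fA AE] := psi_surj _ (facial_set0 q).
  have : psi finset.set0 \subset psi A.
    by rewrite psi_sub ?finset.sub0set //; exact: facial_set0.
  by rewrite AE finset.subset0 => /eqP.
(* Atoms go to atoms: for [j] in the image of the singleton of [i], the preimage of the singleton of
   [j] is nonempty and contained in that of [i]. *)
have psi1 i : exists j, psi [set i]%SET = [set j]%SET.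
  have [f1 E1] := psiP _ (p1 i).
  have [P0|[j jP]] := set_0Vmem (psi [set i]%SET).
    have : psi [set i]%SET \subset psi finset.set0 by rewrite P0 finset.sub0set.
    rewrite psi_sub //; last exact: facial_set0.
    by rewrite finset.sub1set finset.in_set0.
  exists j; have [A fA AE] := psi_surj _ (q1 j).
  have : A \subset [set i]%SET by rewrite -psi_sub // AE finset.sub1set.
  rewrite subset1 => /orP[/eqP AE1|/eqP A0]; first by rewrite -AE AE1.
  have := finset.set11 j; by rewrite -AE A0 psi0 inE.
have [s sE] := choice psi1.
have sI : injective s.
  move=> i j ij; apply/eqP; rewrite -finset.in_set1 -finset.sub1set.
  by rewrite -psi_sub // !sE ij.
have psiE A : facial p A -> psi A = (perm sI @: A).
  move=> fA; apply/setP => j.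
  have [i ->] : exists i, j = s i by exists (invF sI j); rewrite f_invF.
  rewrite -finset.sub1set -sE psi_sub // finset.sub1set -(permE sI).
  by rewrite mem_imset //; exact: perm_inj.
exists (perm sI) => [A fA|B fB].
  by rewrite -psiE //; exact: (psiP _ fA).1.
have [A fA <-] := psi_surj _ fB.
rewrite psiE //; suff -> : perm sI @^-1: (perm sI @: A) = A by [].
by apply/setP => i; rewrite inE mem_imset //; exact: perm_inj.
Qed.

End TwoConfigurations.

(** * The hypersimplex as the convex hull of indicator vectors *)

Section Hypersimplex.
Variables (R : realType) (r n : nat).
Implicit Types (x y : 'rV[R]_n) (i j : 'I_n).

Definition fractional x : {set 'I_n} := [set i | 0 < x 0 i < 1]%SET.

Lemma indicator_hypersimplex (B : {set 'I_n}) :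
  #|B| = r -> hypersimplex R r n (indicator_vector R B).
Proof.
move=> Br; split=> [i|]; first by rewrite mxE; case: (_ \in _); rewrite ?lexx ler01.
under eq_bigr do rewrite mxE.
by rewrite -natr_sum -Br -sum1_card [in RHS]big_mkcond /=.
Qed.

Lemma hypersimplex_fractional0 x : hypersimplex R r n x ->
  fractional x = finset.set0 ->
  exists2 B : {set 'I_n}, #|B| = r & x = indicator_vector R B.
Proof.
move=> [x01 xr] fx0; pose B := [set i | x 0 i == 1]%SET.
have xE : x = indicator_vector R B.
  apply/rowP => i; rewrite mxE inE; have /andP[x0 x1] := x01 i.
  have := finset.in_set0 i; rewrite -fx0 finset.in_set.
  have [->//|xn1] := eqVneq (x 0 i) 1.
  rewrite (lt_neqAle (x 0 i)) xn1 x1 !andbT => /negbT.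
  by rewrite -leNgt => x0'; apply/eqP; rewrite eq_le x0'.
exists B => //; apply/eqP; rewrite -(eqr_nat R) -xr xE.
under [X in _ == X]eq_bigr do rewrite mxE.
by rewrite -natr_sum -sum1_card [in X in X == _]big_mkcond.
Qed.

(** If all other coordinates were 0 or 1, then [r] would lie strictly between [#|B|] and [#|B| + 1],
    where [B] collects the ones. *)
Lemma hypersimplex_fractional2 x i : hypersimplex R r n x ->
  i \in fractional x -> exists2 j, j != i & j \in fractional x.
Proof.
move=> [x01 xr] ix; apply/exists_inP; apply: contraPT (ix); rewrite negb_exists_in.
move=> /forall_inP nj.
pose B := [set j | (j != i) && (x 0 j == 1)]%SET.
have : x 0 i + #|B|%:R = r%:R.
  rewrite -xr (bigD1 i) //=; congr (_ + _).
  rewrite -sum1_card natr_sum [LHS]big_mkcond [RHS]big_mkcond /=.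
  apply: eq_bigr => j _; rewrite inE; case: eqVneq => //= ji.
  have := nj j ji; rewrite inE; have /andP[x0 x1] := x01 j.
  have [->//|xn1] := eqVneq (x 0 j) 1.
  rewrite (lt_neqAle (x 0 j)) xn1 x1 !andbT.
  by rewrite -leNgt => x0'; apply/esym/eqP; rewrite eq_le x0'.
rewrite inE => xE /andP[xi0 xi1].
have : #|B|%:R < r%:R :> R by rewrite -xE ltrDr.
have : r%:R < #|B|.+1%:R :> R by rewrite -xE -natr1 addrC ltrD2l.
rewrite !ltr_nat ltnS => H1 H2.
by have := leq_trans H2 H1; rewrite ltnn.
Qed.

(* Push x along e_i - e_j until one of the two coordinates becomes integral. *)
Lemma hypersimplex_push x i j : hypersimplex R r n x -> i != j ->
  i \in fractional x -> j \in fractional x ->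
  exists a, [/\ 0 < a, hypersimplex R r n (x + a *: (delta_mx ord0 i - delta_mx ord0 j)) &
    (#|fractional (x + a *: (delta_mx ord0 i - delta_mx ord0 j))| < #|fractional x|)%N].
Proof.
move=> [x01 xr] ij; rewrite !inE => /andP[xi0 xi1] /andP[xj0 xj1].
pose a := Order.min (1 - x 0 i) (x 0 j); exists a.
have a0 : 0 < a by rewrite lt_min subr_gt0 xi1.
set y := x + _.
have yE k : y 0 k = x 0 k + a * ((k == i)%:R - (k == j)%:R).
  by rewrite !mxE.
have ai : a <= 1 - x 0 i by rewrite ge_min lexx.
have aj : a <= x 0 j by rewrite ge_min lexx orbT.
have yi : y 0 i = x 0 i + a by rewrite yE eqxx (negPf ij) subr0 mulr1.
have yj : y 0 j = x 0 j - a by rewrite yE eqxx eq_sym (negPf ij) sub0r mulrN1.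
have yk k : k != i -> k != j -> y 0 k = x 0 k.
  by rewrite yE => /negPf-> /negPf->; rewrite subrr mulr0 addr0.
split=> //.
  split=> [k|].
    have [->|ki] := eqVneq k i; first by rewrite yi; apply/andP; split; lra.
    have [->|kj] := eqVneq k j; first by rewrite yj; apply/andP; split; lra.
    by rewrite yk.
  under eq_bigr do rewrite yE.
  by rewrite big_split /= -mulr_sumr sumrB !sum_delta subrr mulr0 addr0.
apply/proper_card/properP; split.
  apply/fintype.subsetP => k; rewrite !inE.
  have [->|ki] := eqVneq k i; first by rewrite xi0 xi1.
  have [->|kj] := eqVneq k j; first by rewrite xj0 xj1.
  by rewrite yk.
have [aE|aE] : a = 1 - x 0 i \/ a = x 0 j.
  by rewrite /a; case: leP; auto.
- exists i; rewrite inE ?xi0 //.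
  by rewrite yi aE addrCA subrr addr0 ltxx andbF.
- exists j; rewrite inE ?xj0 //.
  by rewrite yj aE subrr ltxx.
Qed.

(** Induction on the number of fractional coordinates: a non-integral point lies between two
    opposite pushes of it, each of which has fewer. *)
Lemma hypersimplexE : hypersimplex R r n =
  convex_hull [set indicator_vector R B | B in [set B : {set 'I_n} | #|B| = r]].
Proof.
apply/seteqP; split=> [x|x [k [t [p [t0 t1 pB ->]]]]]; last first.
  have pD l : hypersimplex R r n (p l).
    by have [B Br <-] := pB l; exact: indicator_hypersimplex.
  split=> [i|].
    rewrite summxE; apply/andP; split.
      apply: sumr_ge0 => j _; rewrite mxE mulr_ge0 //.
      by have /andP[] := (pD j).1 i.
    rewrite -t1; apply: ler_sum => j _; rewrite mxE ler_piMr //.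
    by have /andP[] := (pD j).1 i.
  under eq_bigr do rewrite summxE; rewrite exchange_big /=.
  under eq_bigr do under eq_bigr do rewrite mxE.
  under eq_bigr do rewrite -mulr_sumr (pD _).2.
  by rewrite -mulr_suml t1 mul1r.
have [N] := ubnP #|fractional x|; elim: N x => // N IH x xN Dx.
have [fx0|[i ix]] := set_0Vmem (fractional x).
  have [B Br ->] := hypersimplex_fractional0 Dx fx0.
  by apply: sub_convex_hull; exists B.
have [j ji jx] := hypersimplex_fractional2 Dx ix.
have [b [b0 Dy yx]] := hypersimplex_push Dx ji jx ix.
rewrite eq_sym in ji; have [a [a0 Dz zx]] := hypersimplex_push Dx ji ix jx.
have ab : a + b != 0 by rewrite gt_eqF // addr_gt0.
pose e : 'rV[R]_n := delta_mx ord0 i - delta_mx ord0 j.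
have -> : x = (b / (a + b)) *: (x + a *: e) +
              (a / (a + b)) *: (x + b *: (delta_mx ord0 j - delta_mx ord0 i)).
  rewrite -(opprB (delta_mx ord0 i)) -/e; apply/rowP => k; rewrite !mxE; field.
  by [].
apply: convex_hull_convex.
- by rewrite divr_ge0 ?addr_ge0 // ltW.
- by rewrite divr_ge0 ?addr_ge0 // ltW.
- by rewrite -mulrDl addrC divff.
- by apply: IH => //; rewrite -ltnS (leq_trans _ xN).
- by apply: IH => //; rewrite -ltnS (leq_trans _ xN).
Qed.

End Hypersimplex.

(** * Dimension of a set spanning a hyperplane of constant coordinate sum *)

Section Dimension.
Variable (R : realType).

(** The direction space is the kernel of the coordinate sum, a nonzero linear form on a space of
    dimension [n + 1]. *)
Lemma has_dim_hyperplane n (s : R) (P : set 'rV[R]_n.+1) x0 : P x0 ->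
  P `<=` [set x : 'rV[R]_n.+1 | \sum_i x 0 i = s] ->
  [set x : 'rV[R]_n.+1 | \sum_i x 0 i = s] `<=` affine_hull P -> has_dim P n.
Proof.
move=> Px0 Ps sP.
pose f : 'Hom('rV[R]_n.+1, 'M_1) := linfun (mulmxr (const_mx 1)).
have fE x : f x = (\sum_i x 0 i)%:M.
  apply/rowP => j; rewrite lfunE ord1 /= !mxE eqxx mulr1n.
  by apply: eq_bigr => i _; rewrite mxE mulr1.
exists x0, (lker f); split.
  have := limg_ker_dim f fullv; rewrite capfv dimvf /dim /= mul1n.
  suff -> : \dim (limg f) = 1%N by rewrite addn1 => -[].
  apply/eqP; rewrite eqn_leq; apply/andP; split.
    by rewrite (leq_trans (dimvS (subvf _))) // dimvf.
  rewrite lt0n dimv_eq0; apply/eqP => f0.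
  have : f (delta_mx 0 ord0) \in limg f by rewrite memv_img ?memvf.
  rewrite f0 memv0 fE; under eq_bigr do rewrite mxE.
  rewrite sum_delta => /eqP/rowP/(_ 0); rewrite !mxE eqxx => /eqP.
  by rewrite oner_eq0.
have x0s := Ps _ Px0.
apply/seteqP; split=> [x [k [t [p [t1 Pp ->]]]]|x [u uU <-]]; last first.
  apply: sP => /=; move: uU => /=; rewrite memv_ker => /eqP/rowP/(_ 0); rewrite fE !mxE eqxx mulr1n => u0.
  under eq_bigr do rewrite mxE.
  by rewrite big_split /= u0 addr0.
exists (\sum_i t i *: p i - x0); last by rewrite addrC subrK.
rewrite /= memv_ker linearB /= linear_sum /= fE x0s.
under eq_bigr do rewrite linearZ /= fE (Ps _ (Pp _)).
by rewrite -scaler_suml t1 scale1r subrr.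
Qed.

End Dimension.

(** * Integral tables of points and Boolean certificates *)

Definition table_row (T : seq (seq nat)) (i : nat) : seq nat := nth [::] T i.

Definition dotn (c x : seq nat) : nat :=
  sumn [seq (nth 0 c l * nth 0 x l)%N | l <- iota 0 5].

Definition config (R : realType) (T : seq (seq nat)) (i : 'I_10) : 'rV[R]_5 :=
  \row_l (nth 0%N (table_row T i) l)%:R.

(** Negative coefficients can be avoided: the rows of each table used have the same coordinate sum,
    so adding a constant to all coefficients does not change what is exposed. *)
Definition exposes T (c : seq nat) (s : seq nat) (b : nat) : bool :=
  all (fun k => let d := dotn c (table_row T k) in
                if k \in s then d == b else (d < b)%N) (iota 0 10).

(** An affine dependency between rows, its negative terms moved across so that both sides have
    natural weights. *)
Definition balanced T (u w : seq nat) : bool :=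
  (sumn [seq nth 0 u k | k <- iota 0 10] ==
   sumn [seq nth 0 w k | k <- iota 0 10])%N &&
  all (fun l =>
    sumn [seq (nth 0 u k * nth 0 (table_row T k) l)%N | k <- iota 0 10] ==
    sumn [seq (nth 0 w k * nth 0 (table_row T k) l)%N | k <- iota 0 10])
  (iota 0 5).

(* Rows are the vertices e_a + e_b of the hypersimplex, in the order
   12, 13, 14, 15, 23, 24, 25, 34, 35, 45. *)
Definition pair_table : seq (seq nat) :=
  [:: [:: 1; 1; 0; 0; 0]; [:: 1; 0; 1; 0; 0]; [:: 1; 0; 0; 1; 0];
      [:: 1; 0; 0; 0; 1]; [:: 0; 1; 1; 0; 0]; [:: 0; 1; 0; 1; 0];
      [:: 0; 1; 0; 0; 1]; [:: 0; 0; 1; 1; 0]; [:: 0; 0; 1; 0; 1];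
      [:: 0; 0; 0; 1; 1]]%N.

(* All points are scaled by 10 to keep the coordinates integral. *)
Definition pushed_table : seq (seq nat) :=
  [:: 7; 7; 2; 2; 2]%N :: map (map (muln 10)) (behead pair_table).

(** The dot product counts common elements. A pair meets itself, so this is adjacency or equality in
    the common graph, and vertices are handled as degenerate edges. *)
Definition meets (i j : nat) : bool :=
  dotn (table_row pair_table i) (table_row pair_table j) != 0%N.

Lemma meetsC i j : meets i j = meets j i.
Proof. by rewrite /meets /dotn; under eq_map do rewrite mulnC. Qed.

Definition edge_functional (a b i j : nat) : seq nat :=
  mkseq (fun l => a * nth 0 (table_row pair_table i) l +
                  b * nth 0 (table_row pair_table j) l)%N 5.

Definition multiplicities (s : seq nat) : seq nat :=
  mkseq (fun k => count_mem k s) 10.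

(** The segments [i j] and [k l] share their midpoint, so a face through [i] and [j] contains [k].
    The values [k = i] and [k = j] are included. *)
Definition parallelogram T (i j k : nat) : bool :=
  has (fun l => balanced T (multiplicities [:: i; j]) (multiplicities [:: k; l]))
      (iota 0 10).

Lemma all_iotaP n (P : nat -> nat -> bool) :
  all (fun i => all (P i) (iota 0 n)) (iota 0 n) -> forall i j : 'I_n, P i j.
Proof.
move=> /allP H i j; have mem (k : 'I_n) : val k \in iota 0 n by rewrite mem_iota ltn_ord.
exact: (allP (H _ (mem i)) _ (mem j)).
Qed.

Lemma sumn_iota n (F : nat -> nat) :
  sumn [seq F k | k <- iota 0 n] = (\sum_(k < n) F k)%N.
Proof. by rewrite sumnE big_map -(big_mkord xpredT) /index_iota subn0. Qed.

Lemma card_val_set n (P : pred nat) :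
  #|[set i : 'I_n | P (val i)]%SET| = count P (iota 0 n).
Proof.
by rewrite cardsE cardE /enum_mem size_filter -enumT -val_enum_ord count_map.
Qed.

(** * Vertices and edges of both configurations, and the face that tells them apart *)

Section Configurations.
Variable R : realType.
Implicit Types (T : seq (seq nat)) (A : {set 'I_10}).

Lemma exposes_facial T c s b : exposes T c s b ->
  facial (config R T) [set i : 'I_10 | val i \in s]%SET.
Proof.
move=> /allP H; exists (\row_l (nth 0%N c l)%:R), b%:R => i.
have -> : dot (\row_l (nth 0%N c l)%:R) (config R T i) =
    (dotn c (table_row T i))%:R.
  rewrite /dotn sumn_iota natr_sum; apply: eq_bigr => l _.
  by rewrite !mxE natrM.
have := H (val i); rewrite mem_iota inE => /(_ (ltn_ord i)) /=.
rewrite /Order.leif eqr_nat ler_nat; case: ifP => _ H'.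
  by rewrite (eqP H') leqnn eqxx.
by rewrite ltnW // ltn_eqF.
Qed.

Lemma balanced_facial T u w A (k : 'I_10) : facial (config R T) A -> balanced T u w ->
  (forall i : 'I_10, (0 < nth 0 u i)%N -> i \in A) ->
  (0 < nth 0 w k)%N -> k \in A.
Proof.
move=> fA /andP[/eqP uw /allP uwT] uA wk; move: uw; rewrite !sumn_iota => uw.
apply: (@facial_weights _ _ _ _ A (fun i => (nth 0%N u i)%:R)
  (fun i => (nth 0%N w i)%:R) k fA).
- by move=> i; exact: ler0n.
- by move=> i; rewrite pnatr_eq0 -lt0n; exact: uA.
- by rewrite -!natr_sum uw.
- apply/rowP => l; rewrite !summxE.
  under eq_bigr do rewrite !mxE -natrM.
  under [RHS]eq_bigr do rewrite !mxE -natrM.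
  have := uwT (val l); rewrite mem_iota => /(_ (ltn_ord l)).
  by rewrite !sumn_iota -!natr_sum => /eqP ->.
- by rewrite ltr0n.
Qed.

Lemma parallelogram_facial T A (i j k : 'I_10) : facial (config R T) A ->
  i \in A -> j \in A -> parallelogram T i j k -> k \in A.
Proof.
move=> fA iA jA /hasP[l _ H]; apply: (balanced_facial fA H) => [m|].
  rewrite nth_mkseq ?ltn_ord //= addn0.
  case: eqP => [/val_inj <-//|_]; case: eqP => [/val_inj <-//|_].
  by [].
by rewrite nth_mkseq ?ltn_ord //= eqxx.
Qed.

Lemma pair_set_facial T (i j : 'I_10) c b :
  exposes T c [:: val i; val j] b -> facial (config R T) [set i; j]%SET.
Proof.
move=> /exposes_facial; congr facial; apply/setP => k.
by rewrite !inE.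
Qed.

(** Two disjoint pairs form a diagonal of an octahedron, whose other diagonals have the same
    midpoint. For meeting pairs, the sum of their indicator vectors is maximal exactly at these
    two. *)
Lemma pair_table_facial (i j : 'I_10) :
  facial (config R pair_table) [set i; j]%SET <-> meets i j.
Proof.
split=> [fij|ij].
  apply: contraT => nij.
  have H : all (fun i => all (fun j => meets i j || has
    (fun k => [&& k != i, k != j & parallelogram pair_table i j k]) (iota 0 10))
    (iota 0 10)) (iota 0 10) by vm_compute.
  have := all_iotaP H i j; rewrite (negPf nij) orFb.
  move=> /hasP[k]; rewrite mem_iota => /= k10 /and3P[ki kj Hk].
  have := @parallelogram_facial _ _ i j (Ordinal k10) fij.
  rewrite !in_set2 !eqxx orbT -!val_eqE /= (negPf ki) (negPf kj).
  by move=> /(_ isT isT Hk).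
have H : all (fun i => all (fun j => meets i j ==>
   let c := edge_functional 1 1 i j in
   exposes pair_table c [:: i; j] (dotn c (table_row pair_table i)))
   (iota 0 10)) (iota 0 10) by vm_compute.
by have /implyP/(_ ij)/pair_set_facial := all_iotaP H i j.
Qed.

(* The segment from the pushed vertex to a vertex e_a + e_b disjoint from 12
   crosses the interior of the prism spanned by the neighbours of 12: with weights
   10 and 4 its endpoints balance these positive weights on the prism. *)
Definition prism_weights (j : nat) : seq nat :=
  mkseq (fun k => if (0 < k < 7)%N then (if meets k j then 3 else 1)%N else 0%N) 10.

(** Only row 0 has moved, and its non-edges are refuted by the prism. The octahedron of two other
    disjoint pairs still has a second diagonal that does not end in 12. *)
Lemma pushed_table_facial (i j : 'I_10) :
  facial (config R pushed_table) [set i; j]%SET <-> meets i j.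
Proof.
split=> [fij|ij].
  wlog leij : i j fij / (i <= j)%N.
    move=> H; have [|/ltnW ji] := leqP i j; first exact: H.
    by rewrite meetsC; apply: H ji; rewrite finset.setUC.
  apply: contraT => nij.
  have [i0|i0] := eqVneq (val i) 0%N.
    have H : all (fun i => all (fun j => [|| i != 0%N, meets i j |
       (1%N != j) && balanced pushed_table
       (multiplicities (nseq 10 0 ++ nseq 4 j)) (prism_weights j)])
       (iota 0 10)) (iota 0 10) by vm_compute.
    have := all_iotaP H i j; rewrite [in val i != _]i0 (negPf nij).
    move=> /andP[j1 B].
    (* Row 1, which is 13, has positive prism weight for every [j], so it would be a third point of
       the edge. *)
    have : (inord 1 : 'I_10) \in [set i; j]%SET.
      apply: (balanced_facial fij B) => [m|]; last by rewrite inordK //=; case: (meets _ _).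
      rewrite nth_mkseq ?ltn_ord // count_cat !count_nseq /=.
      rewrite in_set2 -!val_eqE /= i0 !(eq_sym (val m)).
      by case: eqP => //; case: eqP.
    by rewrite in_set2 -!val_eqE /= inordK // i0 (negPf j1).
  have H : all (fun i => all (fun j => [|| i == 0%N, (j < i)%N, meets i j | has
    (fun k => [&& k != i, k != j & parallelogram pushed_table i j k]) (iota 0 10)])
    (iota 0 10)) (iota 0 10) by vm_compute.
  have := all_iotaP H i j; rewrite (negPf i0) (negPf nij) ltnNge leij !orFb.
  move=> /hasP[k]; rewrite mem_iota => /= k10 /and3P[ki kj Hk].
  have := @parallelogram_facial _ _ i j (Ordinal k10) fij.
  rewrite !in_set2 !eqxx orbT -!val_eqE /= (negPf ki) (negPf kj).
  by move=> /(_ isT isT Hk).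
(* With coefficients [a] for 12 and [b] for a neighbour, the functional takes the values
   [14 a + 9 b] and [10 a + 20 b] at these two; they agree when [4 a = 11 b], whence 11 and 4. *)
have H : all (fun i => all (fun j => meets i j ==>
   let wt i j := (if i == 0 then 11 else if j == 0 then 4 else 1)%N in
   let c := edge_functional (wt i j) (wt j i) i j in
   exposes pushed_table c [:: i; j] (dotn c (table_row pushed_table i)))
   (iota 0 10)) (iota 0 10) by vm_compute.
by have /implyP/(_ ij)/pair_set_facial := all_iotaP H i j.
Qed.

Lemma meets_refl (i : 'I_10) : meets i i.
Proof.
have H : all (fun i => all (fun j => (i == j) ==> meets i j) (iota 0 10)) (iota 0 10).
  by vm_compute.
by have /implyP := all_iotaP H i i; apply.
Qed.

Lemma pair_table_facial1 i : facial (config R pair_table) [set i]%SET.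
Proof. by rewrite -(finset.setUid [set i]%SET); apply/pair_table_facial/meets_refl. Qed.

Lemma pushed_table_facial1 i : facial (config R pushed_table) [set i]%SET.
Proof. by rewrite -(finset.setUid [set i]%SET); apply/pushed_table_facial/meets_refl. Qed.

Lemma graph_isomorphic_pushed :
  graph_isomorphic (hull (config R pushed_table)) (hull (config R pair_table)).
Proof.
apply: graph_isomorphic_hull => [||i j].
- exact: pushed_table_facial1.
- exact: pair_table_facial1.
- by rewrite pair_table_facial pushed_table_facial.
Qed.

(* The witness is the square 13, 14, 23, 24, with diagonal 13, 24. *)
Lemma not_combinatorially_equivalent_pushed :
  ~ combinatorially_equivalent (hull (config R pushed_table))
      (hull (config R pair_table)).
Proof.
move=> /(combinatorially_equivalent_hull pushed_table_facial1 pair_table_facial1).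
move=> [s sA sB].
have fS : facial (config R pushed_table)
    [set i : 'I_10 | val i \in [:: 1; 2; 4; 5]%N]%SET.
  (* The value is 90 on the square and 86 at the pushed vertex; at the former position of 12 it
     would be 100. *)
  by apply: (@exposes_facial _ [:: 5; 5; 4; 4; 0]%N _ 90); vm_compute.
pose a : 'I_10 := inord 1; pose b : 'I_10 := inord 5; pose c : 'I_10 := inord 2.
(* If the diagonal maps to an edge, pulling back makes 13, 24 a facial pair, but 13 + 24 = 14 + 23
   forces 14 into it. *)
have [ab|ab] := boolP (meets (s a) (s b)).
  have fab := sB _ ((pair_table_facial _ _).2 ab).
  have := parallelogram_facial (i := a) (j := b) (k := c) fab.
  rewrite !inE !eqxx orbT.
  have -> : parallelogram pushed_table a b c by rewrite !inordK //; vm_compute.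
  move=> /(_ isT isT isT); rewrite !(inj_eq perm_inj) -!val_eqE /=.
  by rewrite !inordK.
(* Otherwise it maps to two disjoint pairs. All six vertices of their octahedron, these two
   included, lie in the image of the square, which has only four. *)
have H : all (fun i => all (fun j => meets i j ||
   (6 <= count (parallelogram pair_table i j) (iota 0 10))%N) (iota 0 10))
   (iota 0 10) by vm_compute.
have := all_iotaP H (s a) (s b); rewrite (negPf ab) orFb leqNgt => /negP; apply.
set S := [set i | _]%SET in fS; rewrite -card_val_set.
have S4 : #|s @: S| = 4%N by rewrite card_imset ?card_val_set //; exact: perm_inj.
apply: (@leq_ltn_trans #|s @: S|); last by rewrite S4.
apply/subset_leq_card/fintype.subsetP => k; rewrite inE.
have sS (l : nat) : l \in [:: 1; 2; 4; 5]%N -> s (inord l) \in s @: S.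
  move=> lS; apply: imset_f; rewrite inE /= inordK //.
  by move: lS; rewrite !inE => /or4P[] /eqP->.
by apply: parallelogram_facial; [exact: sA | exact: sS | exact: sS].
Qed.

End Configurations.

(** * The hypersimplex of type (2, 5), dimensions and uniform matroids *)

Section Polytopes25.
Variable R : realType.

Lemma range_pair_table : range (config R pair_table) =
  [set indicator_vector R B | B in [set B : {set 'I_5} | #|B| = 2%N]].
Proof.
apply/seteqP; split=> [_ [i _ <-]|_ [B B2 <-]].
  exists [set l : 'I_5 | nth 0%N (table_row pair_table i) (val l) == 1%N]%SET => /=.
    rewrite (card_val_set 5 (fun l => nth 0%N (table_row pair_table i) l == 1%N)).
    by case: i => [] [|[|[|[|[|[|[|[|[|[|]]]]]]]]]].
  apply/rowP => l; rewrite !mxE inE; congr _%:R; move: i l.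
  have H : all (fun i => all (fun l => (l < 5)%N ==> (nth 0%N (table_row pair_table i) l < 2)%N)
    (iota 0 10)) (iota 0 10) by vm_compute.
  move=> i l; have := allP (allP H i _) l.
  rewrite !mem_iota !ltn_ord (leq_trans (ltn_ord l)) //= => /(_ isT isT).
  by case: nth => [|[|]].
(* As a Boolean list of length 5, [B] can be located in the table by going through all such
   lists. *)
pose s := [seq l \in B | l <- enum 'I_5].
have s2 : count id s = #|B|.
  by rewrite count_map cardE [in RHS]/enum_mem size_filter -enumT.
have sD : map nat_of_bool s \in pair_table.
  have : size s = 5 by rewrite size_map size_enum_ord.
  rewrite B2 in s2; move: s2; clearbody s.
  case: s => [|[] [|[] [|[] [|[] [|[] []]]]]] //.
have i10 : (index (map nat_of_bool s) pair_table < 10)%N by rewrite index_mem.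
exists (Ordinal i10) => //; apply/rowP => l.
rewrite !mxE /table_row nth_index //; congr _%:R.
have ls : (l < size s)%N by rewrite size_map size_enum_ord.
rewrite (nth_map false) // (nth_map l) ?nth_ord_enum //.
by rewrite size_map in ls.
Qed.

Lemma hypersimplex25 : hypersimplex R 2 5 = hull (config R pair_table).
Proof. by rewrite hypersimplexE -range_pair_table. Qed.

(* The vertices 13, 14, 15, 23, 34 affinely span the hyperplane. *)
Lemma has_dim_config (T : seq (seq nat)) (h : nat) : (0 < h)%N ->
  (forall i, (i < 10)%N -> dotn (nseq 5 1%N) (table_row T i) = (2 * h)%N) ->
  (forall i, i \in [:: 1; 2; 3; 4; 7]%N ->
     table_row T i = map (muln h) (table_row pair_table i)) ->
  has_dim (hull (config R T)) 4.
Proof.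
move=> h0 Ts TE.
apply: (has_dim_hyperplane (s := (2 * h)%:R) (mem_hull (config R T) ord0)).
  move=> x; rewrite hullE => -[w [_ _ w1 ->]] /=.
  under eq_bigr do rewrite summxE; rewrite exchange_big /=.
  rewrite -[RHS]mul1r -[X in _ = X * _]w1 mulr_suml; apply: eq_bigr => i _.
  rewrite -(Ts i) // /dotn sumn_iota  natr_sum mulr_sumr; apply: eq_bigr => l _.
  by rewrite !mxE nth_nseq ltn_ord mul1n.
move=> x /= xs.
have h0R : h%:R != 0 :> R by rewrite pnatr_eq0 -lt0n.
pose z k := x 0 (inord k).
(* Coordinates 5 and 2 occur only in 15 and 23, whose weights are read off; the other three weights
   solve the triangle 13, 14, 34, whence the denominator [2 * h]. *)
exists 5%N, (fun i : 'I_5 => nth 0 [:: (z 0%N - z 4%N + z 2%N - z 1%N - z 3%N) / (2 * h%:R);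
  (z 0%N - z 4%N - z 2%N + z 1%N + z 3%N) / (2 * h%:R); z 4%N / h%:R; z 1%N / h%:R;
  (z 3%N - z 0%N + z 4%N + z 2%N - z 1%N) / (2 * h%:R)] i).
exists (fun i : 'I_5 => config R T (inord (nth 0 [:: 1; 2; 3; 4; 7] i)))%N.
have zE : z 0%N + z 1%N + z 2%N + z 3%N + z 4%N = 2 * h%:R.
  move: xs; rewrite natrM => <-; rewrite !big_ord_recl big_ord0 /z.
  rewrite !addrA addr0; congr (_ + _ + _ + _ + _); congr (x 0 _);
    by apply: val_inj; rewrite /= inordK.
split.
- rewrite !big_ord_recl big_ord0 /=.
  apply: (mulfI (mulf_neq0 (x := 2) _ h0R)); first by rewrite pnatr_eq0.
  rewrite mulr1 -[RHS]zE; field.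
  by [].
- by move=> i; apply: mem_hull.
- apply/rowP => l; rewrite !big_ord_recl big_ord0 /= !mxE !inordK //.
  rewrite !TE //.
  have -> : x 0 l = z l by rewrite /z inord_val.
  case: l => [] [|[|[|[|[|]]]]] //= _; rewrite ?muln0 ?muln1; field; by [].
Qed.

Lemma dim_hypersimplex25 : has_dim (hypersimplex R 2 5) 4.
Proof.
rewrite hypersimplex25; apply: (@has_dim_config _ 1) => //.
  by case=> [|[|[|[|[|[|[|[|[|[|]]]]]]]]]].
by move=> i; rewrite !inE => /or4P[|||/orP[]] /eqP->.
Qed.

Lemma dim_pushed : has_dim (hull (config R pushed_table)) 4.
Proof.
apply: (@has_dim_config _ 10) => //.
  by case=> [|[|[|[|[|[|[|[|[|[|]]]]]]]]]].
by move=> i; rewrite !inE => /or4P[|||/orP[]] /eqP->.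
Qed.

Lemma polytope_pushed : is_polytope (hull (config R pushed_table)).
Proof. by exists (range (config R pushed_table)) => //; exact: finite_image. Qed.

Definition uniform_bases (r n : nat) : {set {set 'I_n}} :=
  [set B : {set 'I_n} | #|B| == r]%SET.

Lemma uniform_bases_neq0 r n : (r <= n)%N -> uniform_bases r n != finset.set0.
Proof.
by move=> rn; rewrite -card_gt0 card_draws card_ord bin_gt0.
Qed.

(** Only cardinality counts, so any [b] in [B :\: A] serves; if there is none, [A] and [B], having
    equal size, coincide. *)
Lemma uniform_bases_exchange r n (A B : {set 'I_n}) (a : 'I_n) :
  A \in uniform_bases r n -> B \in uniform_bases r n -> a \in A :\: B ->
  exists2 b, b \in B :\: A & b |: (A :\ a) \in uniform_bases r n.
Proof.
rewrite !inE => /eqP Ar /eqP Br /andP[aB aA].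
have [BA0|[b bBA]] := set_0Vmem (B :\: A).
  have /eqP BA : B == A.
    by rewrite eqEcard Ar Br leqnn andbT -finset.setD_eq0 BA0.
  by rewrite BA aA in aB.
exists b => //; move: bBA; rewrite inE => /andP[bA bB].
rewrite finset.in_set cardsU1 !inE (negPf bA) andbF /=.
by rewrite -Ar (cardsD1 a A) aA.
Qed.

Definition uniform_matroid r n (rn : (r <= n)%N) : matroid n :=
  Matroid (uniform_bases_neq0 rn) (@uniform_bases_exchange r n).

Lemma uniform_matroid_polytope r n (rn : (r <= n)%N) :
  matroid_polytope R (uniform_matroid rn) = hypersimplex R r n.
Proof.
rewrite hypersimplexE /matroid_polytope; congr (convex_hull (_ @` _)).
by apply/seteqP; split=> B /=; rewrite inE => /eqP.
Qed.

End Polytopes25.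

Theorem proposition24 (R : realType) :
  (exists (r n m : nat) (Q : set 'rV[R]_m),
     [/\ (0 < r < n)%N /\ is_polytope Q,
         has_dim (hypersimplex R r n) n.-1,
         has_dim Q n.-1,
         graph_isomorphic Q (hypersimplex R r n) &
         ~ combinatorially_equivalent Q (hypersimplex R r n)]) /\
  (exists (n : nat) (M : matroid n), ~ reconstructible (matroid_polytope R M)).
Proof.
have dimQ := dim_pushed R; have polQ := polytope_pushed R.
have dimD := dim_hypersimplex25 R; have isoQ := graph_isomorphic_pushed R.
have nequiv := @not_combinatorially_equivalent_pushed R.
rewrite -hypersimplex25 in isoQ nequiv.
split; first by exists 2, 5, 5, (hull (config R pushed_table)).
exists 5, (uniform_matroid (isT : 2 <= 5)%N).
rewrite uniform_matroid_polytope => rec; apply: nequiv.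
exact: rec dimD polQ dimQ isoQ.
Qed.
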